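(* For every real $\sigma>0$ and every real $\varepsilon>0$ there exists an integer $k_0=k_0(\sigma,\varepsilon)$ such that, for every integer $k\ge k_0$ and every integer $n$ satisfying $\nu=\frac{n}{k+1}\ge 1+\sigma$, \[ -\varepsilon<\frac{M(n,k)}{\nu\log\log(k+1)}-\Phi(\nu)<\varepsilon . \]
   Context: All graphs are finite, simple and undirected; all logarithms are natural. For a connected graph $G$, a set $D\subseteq V(G)$ is a dominating set if every vertex of $V(G)\setminus D$ has a neighbor in $D$; it is a connected dominating set if moreover the induced subgraph $G[D]$ is connected. The domination number $\gamma(G)$ (respectively the connected domination number $\gamma_c(G)$) is the minimum cardinality of a dominating set (respectively connected dominating set) of $G$. For integers $n,k$ with $n-1\ge k>1$, $M(n,k)$ denotes the maximum of $\gamma_c(G)-\gamma(G)$ over all connected graphs $G$ with $n$ vertices and minimum degree at least $k$. For real $x>1$, $\Phi(x)=\dfrac{1}{x\log\frac{x}{x-1}}$. *)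

(* Defs.v *)
From HB Require Import structures.
From mathcomp Require Import all_boot all_order all_algebra.
From mathcomp Require Import reals exp.
Set Implicit Arguments.
Unset Strict Implicit.
Unset Printing Implicit Defensive.
Import Order.TTheory GRing.Theory Num.Theory.

Section Graph.
Variables (T : finType) (e : rel T).

Definition simple_graph : bool :=
  [forall x, ~~ e x x] && [forall x, forall y, e x y == e y x].

Definition degree (x : T) : nat := #|[set y | e x y]|.

Definition min_degree_ge (k : nat) : bool := [forall x, k <= degree x].

Definition induced (D : {set T}) : rel T :=
  [rel x y | [&& x \in D, y \in D & e x y]].

(* The empty set counts as connected; this never matters on a nonempty vertex
   set, where the empty set is not dominating. *)
Definition connected_on (D : {set T}) : bool :=
  [forall x in D, forall y in D, connect (induced D) x y].

Definition connected_graph : bool := connected_on [set: T].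

Definition dominating (D : {set T}) : bool :=
  [forall x in ~: D, exists y in D, e x y].

Definition connected_dominating (D : {set T}) : bool :=
  dominating D && connected_on D.

Definition gamma : nat :=
  #|[arg min_(D < [set: T] | dominating D) #|D|]|.

(* The minimum is meaningful for connected graphs only: the default [set: T]
   is then itself a connected dominating set. *)
Definition gammac : nat :=
  #|[arg min_(D < [set: T] | connected_dominating D) #|D|]|.

Lemma dominatingT : dominating [set: T].
Proof. by apply/forall_inP => x; rewrite !inE. Qed.

Lemma gamma_le_gammac : connected_graph -> gamma <= gammac.
Proof.
move=> cT; rewrite /gamma /gammac.
case: arg_minnP => [|D _ minD]; first exact: dominatingT.
case: arg_minnP => [|C /andP[domC _] _]; last exact: minD.
by rewrite /connected_dominating dominatingT.
Qed.

End Graph.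

(* A graph on n vertices is given by its neighbourhood function
   N : 'I_n -> {set 'I_n}. The truncated subtraction is exact by
   gamma_le_gammac, and the range is nonempty (it contains the complete graph)
   when k <= n - 1. *)
Definition M (n k : nat) : nat :=
  \max_(N : {ffun 'I_n -> {set 'I_n}}
       | let e := [rel x y | y \in N x] in
         [&& simple_graph e, connected_graph e & min_degree_ge e k])
    (gammac [rel x y | y \in N x] - gamma [rel x y | y \in N x]).

Local Open Scope ring_scope.

Definition Phi (R : realType) (x : R) : R := 1 / (x * ln (x / (x - 1))).

(* Main.v *)
Require Import Defs.
From mathcomp Require Import all_boot all_order all_algebra.
From mathcomp Require Import reals sequences exp.
From mathcomp Require Import zify ring lra.
Import Order.TTheory GRing.Theory Num.Theory.
Set Implicit Arguments.
Unset Strict Implicit.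
Unset Printing Implicit Defensive.

(** Write K = k + 1, nu = n / K, u = log log K and
    rate nu = log (nu / (nu - 1)), so that nu * Phi nu = 1 / rate nu. The claim
    is that M n k equals u / rate nu up to an error eps * nu * u.

    Both bounds rest on the averaging argument [greedy_cover]: if every x is
    related to a proportion at least q of the candidates y, then m candidates
    chosen greedily leave at most a fraction (1 - q)^m of the x uncovered.
    A closed neighbourhood contains a proportion at least 1 / nu of the
    vertices and 1 - 1 / nu = exp (- rate nu), so about a / rate nu vertices
    dominate all but a fraction exp (- a) of any prescribed set of vertices.

    Upper bound ([M_upper]). A minimum dominating set D has at most
    2 nu log K vertices. Taking a = u, a set S1 of about u / rate nu vertices
    dominates all of D except at most 2 nu vertices. Taking a = log u, a set S2
    of about nu log u vertices dominates all of S1 except at most 2 nu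
    vertices. The union of D, S1 and S2 is dominating, and its components are
    represented by S2 and by the exceptional vertices; two further vertices
    per representative connect it ([connected_dominating_extension]). Of all
    the vertices added to D, only those of S1 are not negligible against nu u.

    Lower bound ([M_lower]). The extremal graph is a block graph
    ([block_adj]). Take one block first. It has an independent set D of d
    vertices, a small independent set of witnesses (i, y), each attached to the
    vertex i of D, and a clique B that contains almost all vertices. The
    neighbourhoods in B of the vertices of D, and of the witnesses, are given
    by two families of sets of density slightly above 1 / nu. The set D with
    one vertex of B is dominating. A connected dominating set that contains D
    must hit all the sets of the first family, in order to attach D; one that
    misses the vertex i of D must hit all the sets of the second family, in
    order to dominate the witnesses (i, y). If the first family cannot be hit
    by t points, nor the second one by d + t points, then gammac exceeds d + t
    in both cases ([block_gammac_part]). Greedy covering, applied to the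
    possible hitting sets, shows that a family of m sets can resist s points as
    soon as m is a bit larger than exp (s rate nu) ([hard_family]). With d a
    small multiple of log K, the first family allows t close to
    log d / rate nu, that is, to u / rate nu, while the second one can be taken
    of size about the square root of K, up to a power of log K.

    For large nu a single block is not enough: the vertices are shared out
    among l blocks with nu / l bounded, whose cliques are merged into one, and
    the gaps add up. As 1 / rate nu lies between nu - 1 and nu, this costs only
    a small multiple of nu u ([block_count]). *)

(** * Dominating sets and connected dominating sets *)

Section DominationNumbers.
Variables (T : finType) (e : rel T).

Lemma gamma_le (D : {set T}) : dominating e D -> gamma e <= #|D|.
Proof.
rewrite /gamma; case: arg_minnP => [|C _ minC]; first exact: dominatingT.
exact: minC.
Qed.

Lemma gammaP : exists2 D : {set T}, dominating e D & #|D| = gamma e.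
Proof.
rewrite /gamma; case: arg_minnP => [|D domD _]; first exact: dominatingT.
by exists D.
Qed.

Lemma connected_dominatingT :
  connected_graph e -> connected_dominating e [set: T].
Proof. by move=> ce; rewrite /connected_dominating dominatingT. Qed.

Lemma gammac_le (C : {set T}) : connected_graph e ->
  connected_dominating e C -> gammac e <= #|C|.
Proof.
move=> ce; rewrite /gammac.
case: arg_minnP => [|D _ minD]; first exact: connected_dominatingT.
exact: minD.
Qed.

Lemma gammacP : connected_graph e ->
  exists2 C : {set T}, connected_dominating e C & #|C| = gammac e.
Proof.
move=> ce; rewrite /gammac.
case: arg_minnP => [|D cD _]; first exact: connected_dominatingT.
by exists D.
Qed.

Lemma dominatingP (D : {set T}) :
  reflect (forall x, x \notin D -> exists2 y, y \in D & e x y)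
          (dominating e D).
Proof.
apply: (iffP forall_inP) => [h x xD|h x].
  by apply/exists_inP; apply: h; rewrite inE.
by rewrite inE => xD; apply/exists_inP; apply: h.
Qed.

Lemma connected_onP (D : {set T}) :
  reflect {in D &, forall x y, connect (induced e D) x y}
          (connected_on e D).
Proof.
apply: (iffP forall_inP) => [h x y xD yD|h x xD].
  by move/forall_inP: (h x xD); apply.
by apply/forall_inP => y yD; apply: h.
Qed.

Lemma inducedE (D : {set T}) x y :
  induced e D x y = [&& x \in D, y \in D & e x y].
Proof. by []. Qed.

Lemma connect_induced_sub (A B : {set T}) x y : A \subset B ->
  connect (induced e A) x y -> connect (induced e B) x y.
Proof.
move=> /subsetP sAB; apply: connect_sub => u v /and3P[uA vA euv].
by apply: connect1; rewrite inducedE !sAB.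
Qed.

Lemma connect_neighbor (C : {set T}) x y : x != y ->
  connect (induced e C) x y -> exists2 z, z \in C & e x z.
Proof.
move=> nxy /connectP[[|z p] /= + eqy]; first by rewrite eqy eqxx in nxy.
by case/andP=> /and3P[_ zC exz] _; exists z.
Qed.

(** A path that leaves a set crosses its boundary along some edge. *)
Lemma connect_boundary (P : pred T) x y : connect e x y -> P x -> ~~ P y ->
  exists z w, [/\ P z, ~~ P w & e z w].
Proof.
move=> /connectP[p + ->]; elim: p x => [|z p IH] x /=; first by move=> _ ->.
case/andP=> exz pz Px; case: (boolP (P z)) => Pz; first exact: IH.
by move=> _; exists x, z.
Qed.

Hypothesis sym_e : symmetric e.

Lemma induced_sym (D : {set T}) : connect_sym (induced e D).
Proof.
apply: sym_connect_sym => x y; rewrite !inducedE sym_e.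
by case: (x \in D); case: (y \in D).
Qed.

(** The set R represents the components of the subgraph induced on D, with
    possible repetitions. In a connected graph some component of a dominating
    set D is at distance at most 3 from the rest of D, so that two more
    vertices merge it with another component, which spares a representative. *)
Lemma connected_dominating_extension (D R : {set T}) :
  connected_graph e -> dominating e D -> R \subset D ->
  (forall x, x \in D -> exists2 r, r \in R & connect (induced e D) x r) ->
  exists2 C : {set T}, connected_dominating e C & #|C| <= #|D| + 2 * #|R|.
Proof.
move=> ce; move: {2}#|R| (erefl #|R|) => c.
elim: c D R => [|c IH] D R cardR domD sRD repR.
  exists D; last by rewrite leq_addr.
  rewrite /connected_dominating domD; apply/connected_onP => x y /repR[r].
  by rewrite (cards0_eq cardR) inE.
case: (boolP (connected_on e D)) => [cD|].
  by exists D; rewrite ?leq_addr // /connected_dominating domD.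
move=> /forall_inPn[x xD /forall_inPn[y yD nxy]].
(* A is the component of x in D, and Ap its closed neighbourhood. *)
pose A := [pred z | connect (induced e D) x z].
pose Ap := [pred z | [exists a, [&& a \in D, A a & (a == z) || e a z]]].
have xAp : Ap x.
  by apply/existsP; exists x; rewrite xD eqxx /= connect0.
have yAp : ~~ Ap y.
  apply/existsP => -[a /and3P[aD Aa /orP[/eqP ay|eay]]].
    by move: nxy; rewrite -ay [connect _ _ _]Aa.
  move: nxy; rewrite (connect_trans Aa) //; apply: connect1.
  by rewrite inducedE aD yD.
have conn : connect e x y.
  move/connected_onP: ce => /(_ x y (in_setT _) (in_setT _)).
  by apply: connect_sub => u v /and3P[_ _ euv]; apply: connect1.
have [z [w [zAp wAp ezw]]] := connect_boundary conn xAp yAp.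
(* z w is an edge leaving Ap; w is dominated from another component of D. *)
have [b bD [Ab ewb]] : exists2 b, b \in D & ~~ A b /\ ((w == b) || e w b).
  case: (boolP (w \in D)) => wD.
    exists w => //; rewrite eqxx; split => //; apply: contra wAp => Aw.
    by apply/existsP; exists w; rewrite wD eqxx Aw.
  have [b bD ewb] := dominatingP _ domD w wD.
  exists b; rewrite // ewb orbT; split => //; apply: contra wAp => Ab.
  by apply/existsP; exists b; rewrite bD Ab sym_e ewb orbT.
have [a /and3P[aD Aa eaz]] := existsP zAp.
have [ra raR ara] := repR a aD.
have [rb rbR brb] := repR b bD.
pose D' := z |: (w |: D).
have sDD' : D \subset D'.
  by apply/subsetP => v vD; rewrite !inE vD !orbT.
have cc u v : connect (induced e D) u v -> connect (induced e D') u v.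
  exact: connect_induced_sub.
have zD' : z \in D' by rewrite !inE eqxx.
have wD' : w \in D' by rewrite !inE eqxx orbT.
have czw : connect (induced e D') z w.
  by apply: connect1; rewrite inducedE zD' wD'.
have cwb : connect (induced e D') w b.
  case/orP: ewb => [/eqP->|ewb]; first exact: connect0.
  by apply: connect1; rewrite inducedE wD' (subsetP sDD').
have caz : connect (induced e D') a z.
  case/orP: eaz => [/eqP->|eaz]; first exact: connect0.
  by apply: connect1; rewrite inducedE zD' (subsetP sDD').
have crb v : connect (induced e D') v b -> connect (induced e D') v rb.
  by move=> cvb; apply: connect_trans cvb (cc _ _ brb).
have nrab : ra != rb.
  apply: contra Ab => /eqP rab; rewrite /A /=.
  apply: (connect_trans Aa); apply: (connect_trans ara).
  by rewrite rab induced_sym.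
have rbR' : rb \in R :\ ra by rewrite !inE eq_sym nrab.
have [|||v|C cC sC] := IH D' (R :\ ra).
- by move: cardR; rewrite (cardsD1 ra) raR => -[].
- apply/dominatingP => v; rewrite !inE !negb_or => /and3P[_ _ vD].
  have [v' v'D evv'] := dominatingP _ domD v vD.
  by exists v' => //; apply: (subsetP sDD').
- apply/subsetP => v; rewrite !inE => /andP[_ /(subsetP sRD) ->].
  by rewrite !orbT.
- rewrite !inE => /or3P[/eqP->|/eqP->|vD].
  + by exists rb => //; apply: crb; apply: connect_trans czw cwb.
  + by exists rb => //; apply: crb.
  have [r rR cvr] := repR v vD.
  case: (eqVneq r ra) => [rra|nr].
    exists rb => //; apply: crb; apply: connect_trans (cc _ _ cvr) _.
    rewrite rra.
    apply: connect_trans (connect_trans caz (connect_trans czw cwb)).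
    by rewrite induced_sym; apply: cc.
  by exists r; [rewrite !inE nr|apply: cc].
exists C => //; apply: leq_trans sC _.
have sD' : #|D'| <= 1 + (1 + #|D|).
  by rewrite /D' !cardsU1 leq_add ?leq_b1 // leq_add ?leq_b1.
move: sD' cardR; rewrite (cardsD1 ra R) raR.
by move: (_ :\ _) => R'; clear; lia.
Qed.

End DominationNumbers.

(** * Isomorphism invariance and the maximum M *)

Lemma connect_homo (T T' : finType) (r : rel T) (r' : rel T') (h : T -> T') :
  (forall x y, r x y -> r' (h x) (h y)) ->
  forall x y, connect r x y -> connect r' (h x) (h y).
Proof.
move=> hr x y /connectP[p + ->]; elim: p x => [|z p IH] x /=.
  by move=> _; apply: connect0.
by case/andP=> rxz /IH; apply: connect_trans; apply: connect1; apply: hr.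
Qed.

Section Isomorphism.
Variables (T T' : finType) (e : rel T) (e' : rel T').
Variables (f : T -> T') (g : T' -> T).
Hypotheses (fK : cancel f g) (gK : cancel g f).
Hypothesis fe : forall x y, e' (f x) (f y) = e x y.

Lemma iso_dominating (D : {set T}) : dominating e D -> dominating e' (f @: D).
Proof.
move=> /dominatingP dD; apply/dominatingP => x'; rewrite -(gK x') => xD.
have [|y yD exy] := dD (g x'); first by apply: contra xD => xD; apply: imset_f.
by exists (f y); rewrite ?imset_f ?fe.
Qed.

Lemma iso_connected_on (D : {set T}) :
  connected_on e D -> connected_on e' (f @: D).
Proof.
move=> /connected_onP cD; apply/connected_onP.
move=> _ _ /imsetP[x xD ->] /imsetP[y yD ->].
apply: connect_homo (cD x y xD yD) => u v.
rewrite !inducedE => /and3P[uD vD euv].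
by rewrite !imset_f ?fe.
Qed.

Lemma iso_connected_graph : connected_graph e -> connected_graph e'.
Proof.
move=> /iso_connected_on; have -> // : f @: [set: T] = [set: T'].
by apply/setP => x; rewrite !inE -(gK x) imset_f.
Qed.

Lemma iso_simple_graph : simple_graph e -> simple_graph e'.
Proof.
move=> /andP[/forallP irr /forallP sym]; apply/andP; split; apply/forallP => x.
  by rewrite -(gK x) fe.
by apply/forallP => y; rewrite -(gK x) -(gK y) !fe; apply: (forallP (sym _)).
Qed.

Lemma iso_min_degree_ge k : min_degree_ge e k -> min_degree_ge e' k.
Proof.
move=> /forallP me; apply/forallP => x; apply: leq_trans (me (g x)) _.
rewrite /degree -(card_imset _ (can_inj fK)); apply: subset_leq_card.
by apply/subsetP => _ /imsetP[y + ->]; rewrite !inE -fe gK.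
Qed.

Lemma iso_gamma_le : (gamma e' <= gamma e).
Proof.
have [D dD <-] := gammaP e; rewrite -(card_imset _ (can_inj fK)).
by apply: gamma_le; apply: iso_dominating.
Qed.

Lemma iso_gammac_le : connected_graph e -> (gammac e' <= gammac e).
Proof.
move=> ce; have [D /andP[dD cD] <-] := gammacP ce.
rewrite -(card_imset _ (can_inj fK)); apply: gammac_le.
  exact: iso_connected_graph.
by rewrite /connected_dominating iso_dominating ?iso_connected_on.
Qed.

End Isomorphism.

Section MaximumDifference.
Variables (n k : nat).

(** A property of the values gammac - gamma passes to their maximum; the value
    0 covers an empty range. *)
Lemma M_ind (P : pred nat) : P 0%N ->
  (forall e : rel 'I_n, simple_graph e -> connected_graph e ->
     min_degree_ge e k -> P (gammac e - gamma e)) ->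
  P (M n k).
Proof.
move=> P0 Pe; rewrite /M; apply: (big_ind P) => //.
  by move=> a b Pa Pb; case/orP: (leq_total a b) => ab;
    [rewrite (maxn_idPr ab)|rewrite (maxn_idPl ab)].
by move=> N /and3P[sN cN mN]; apply: Pe.
Qed.

(** Lower bounds on M come from graphs on any vertex type of size n. *)
Lemma M_ge (T : finType) (e : rel T) : #|T| = n ->
  simple_graph e -> connected_graph e -> min_degree_ge e k ->
  (gammac e - gamma e <= M n k).
Proof.
move=> cT; case: n / cT => se ce me.
pose N : {ffun 'I_#|T| -> {set 'I_#|T|}} :=
  [ffun i => [set j | e (enum_val i) (enum_val j)]].
pose e' := [rel x y | y \in N x].
have eN (i j : 'I_#|T|) : e (enum_val i) (enum_val j) = e' i j.
  by rewrite /= ffunE inE.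
have eN' (x y : T) : e' (enum_rank x) (enum_rank y) = e x y.
  by rewrite -eN !enum_rankK.
have ce' : connected_graph e'.
  exact: (iso_connected_graph (@enum_valK T) eN').
apply: leq_trans (_ : gammac e' - gamma e' <= _).
  apply: leq_sub.
    exact: (iso_gammac_le (@enum_valK T) (@enum_rankK T) eN).
  exact: (iso_gamma_le (@enum_rankK T) (@enum_valK T) eN').
rewrite /M; apply: (bigop.bigmax_sup N) => //; apply/and3P; split=> //.
  exact: (iso_simple_graph (@enum_valK T) eN').
exact: (iso_min_degree_ge (@enum_rankK T) (@enum_valK T) eN').
Qed.

End MaximumDifference.

(** * The block graph *)

Definition hitting (I T : finType) (F : I -> {set T}) (S : {set T}) : Prop :=
  forall i, ~~ [disjoint S & F i].

Lemma not_disjointP (T : finType) (A B : {set T}) z :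
  z \in A -> z \in B -> ~~ [disjoint A & B].
Proof. by move=> zA zB; apply/pred0Pn; exists z; rewrite /= zA. Qed.

Section BlockGraph.
(* L indexes the blocks, D the dominating vertices of a block, W the witnesses
   attached to one of them, and B the clique. A vertex b of the clique belongs
   to the block (tau b).1 and has the type (tau b).2 in Q; its neighbours among
   the dominating vertices and the witnesses depend only on its type. Having
   few types is what lets a family FD as small as D resist t points. *)
Variables (L D W Q B : finType) (tau : B -> L * Q).
Variables (FD : D -> {set Q}) (FW : W -> {set Q}) (k t : nat).

Definition vertex : finType := ((L * D) + (L * D * W) + B)%type.

Definition block (v : vertex) : L :=
  match v with
  | inl (inl li) => li.1
  | inl (inr liy) => liy.1.1
  | inr b => (tau b).1
  end.

(** Each edge is listed in one direction only, except in the clique. *)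
Definition block_arc (u v : vertex) : bool :=
  match u, v with
  | inl (inl li), inl (inr liy) => liy.1 == li
  | inl (inl li), inr b => ((tau b).1 == li.1) && ((tau b).2 \in FD li.2)
  | inl (inr liy), inr b => ((tau b).1 == liy.1.1) && ((tau b).2 \in FW liy.2)
  | inr b, inr b' => b != b'
  | _, _ => false
  end.

Definition block_adj : rel vertex := fun u v => block_arc u v || block_arc v u.

Hypotheses (k_gt0 : 0 < k) (L_gt0 : 0 < #|L|) (D_gt1 : 1 < #|D|).
Hypothesis B_large : k < #|B|.
Hypothesis FD_deg : forall l i,
  k <= #|[set b | ((tau b).1 == l) && ((tau b).2 \in FD i)]|.
Hypothesis FW_deg : forall l y,
  k <= #|[set b | ((tau b).1 == l) && ((tau b).2 \in FW y)]|.
Hypothesis FD_hard : forall S : {set Q}, #|S| <= t -> ~ hitting FD S.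
Hypothesis FW_hard : forall S : {set Q}, #|S| <= #|D| + t -> ~ hitting FW S.

Lemma block_adj_sym : symmetric block_adj.
Proof. by move=> u v; rewrite /block_adj orbC. Qed.

Lemma block_simple : simple_graph block_adj.
Proof.
apply/andP; split; apply/forallP => u.
  by rewrite /block_adj orbb; case: u => [[]|b] //=; rewrite eqxx.
by apply/forallP => v; rewrite block_adj_sym.
Qed.

Lemma FD_nbr l i : exists b, block_adj (inl (inl (l, i))) (inr b).
Proof.
have /card_gt0P[b] := leq_trans k_gt0 (FD_deg l i).
by rewrite inE => h; exists b; rewrite /block_adj /= h.
Qed.

Lemma FW_nbr l i y : exists b, block_adj (inl (inr (l, i, y))) (inr b).
Proof.
have /card_gt0P[b] := leq_trans k_gt0 (FW_deg l y).
by rewrite inE => h; exists b; rewrite /block_adj /= h.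
Qed.

Lemma block_connected : connected_graph block_adj.
Proof.
have adj u v : block_adj u v -> connect (induced block_adj [set: vertex]) u v.
  by move=> uv; apply: connect1; rewrite inducedE !inE.
have toB u : exists b, connect (induced block_adj [set: vertex]) u (inr b).
  case: u => [[[l i]|[[l i] y]]|b]; last by exists b.
    by have [b /adj] := FD_nbr l i; exists b.
  by have [b /adj] := FW_nbr l i y; exists b.
apply/connected_onP => u v _ _.
have [b ub] := toB u; have [b' vb] := toB v.
apply: connect_trans ub _; rewrite (induced_sym block_adj_sym).
apply: connect_trans vb _; case: (eqVneq b' b) => [->//|nb].
by apply: adj; rewrite /block_adj /= nb.
Qed.

Lemma block_min_degree : min_degree_ge block_adj k.
Proof.
have viaB u (S : {set B}) : (forall b, b \in S -> block_adj u (inr b)) ->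
    #|S| <= degree block_adj u.
  move=> hS; rewrite -(card_imset _ (@inr_inj (L * D + L * D * W) B)).
  apply: subset_leq_card; apply/subsetP => _ /imsetP[b bS ->].
  by rewrite inE; apply: hS.
apply/forallP => -[[[l i]|[[l i] y]]|b].
- apply: leq_trans (FD_deg l i) (viaB _ _ _) => b.
  by rewrite inE /block_adj /= => ->.
- apply: leq_trans (FW_deg l y) (viaB _ _ _) => b.
  by rewrite inE /block_adj /= => ->.
- apply: leq_trans (viaB _ ([set: B] :\ b) _).
    by rewrite -ltnS; move: B_large; rewrite -cardsT (cardsD1 b) inE.
  by move=> b'; rewrite !inE andbT /block_adj /= => ->; rewrite orbT.
Qed.

Lemma block_gamma : gamma block_adj <= #|L| * #|D| + 1.
Proof.
have /card_gt0P[b0 _] : 0 < #|B| by apply: leq_ltn_trans B_large.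
pose D0 : {set vertex} := inr b0 |: [set inl (inl li) | li in [set: L * D]].
apply: leq_trans (_ : #|D0| <= _).
  apply: gamma_le; apply/dominatingP => -[[li|liy]|b].
  - by rewrite !inE imset_f ?orbT // inE.
  - move=> _; exists (inl (inl liy.1)); last by rewrite /block_adj /= eqxx.
    by rewrite inE imset_f ?orbT // inE.
  - rewrite !inE negb_or => /andP[nb _].
    exists (inr b0); first by rewrite !inE eqxx.
    by rewrite /block_adj /=; apply/orP; left; apply: contra nb => /eqP->.
rewrite cardsU1 addnC leq_add ?leq_b1 //.
by apply: leq_trans (leq_imset_card _ _) _; rewrite cardsT card_prod.
Qed.

(** Replacing every chosen vertex of the block by a type turns C into a hitting
    set: a chosen witness serves only itself and the vertex it is attached to,
    so it may be replaced by any point of the corresponding set. If C contains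
    all the dominating vertices of the block, these have to be attached to
    the rest of C and the types hit FD; if C misses one of them, its witnesses
    have to be dominated by the clique and the types hit FW. *)
Lemma block_gammac_part (C : {set vertex}) (l : L) :
  connected_dominating block_adj C ->
  #|D| + t < #|[set v in C | block v == l]|.
Proof.
move=> /andP[/dominatingP domC /connected_onP connC].
set Cl := [set v in C | block v == l]; rewrite ltnNge; apply/negP => sCl.
have /card_gt0P[i0 _] := ltnW D_gt1.
have pD i : {b | b \in FD i}.
  apply: sigW; have [b] := FD_nbr l i; rewrite /block_adj /= orbF => /andP[_ h].
  by exists (tau b).2.
have pW y : {b | b \in FW y}.
  apply: sigW; have [b] := FW_nbr l i0 y.
  rewrite /block_adj /= orbF => /andP[_ h].
  by exists (tau b).2.
have [/forallP allD|/forallPn[i nDi]] :=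
  boolP [forall i, inl (inl (l, i)) \in C].
- pose Dl : {set vertex} := [set inl (inl (l, i)) | i in [set: D]].
  pose f (v : vertex) := match v with
    | inl (inl li) => sval (pD li.2)
    | inl (inr liy) => sval (pD liy.1.2)
    | inr b => (tau b).2 end.
  have sDl : Dl \subset Cl.
    by apply/subsetP => _ /imsetP[i _ ->]; rewrite inE allD /=.
  apply: (@FD_hard (f @: (Cl :\: Dl))).
    apply: leq_trans (leq_imset_card _ _) _.
    rewrite cardsD (setIidPr sDl) leq_subLR; apply: leq_trans sCl _.
    by rewrite leq_add2r /Dl card_imset ?cardsT // => i j [].
  (* As C is connected and has a second vertex, each vertex of D has a
     neighbour in C, which lies outside D. *)
  move=> i.
  have [j nij] : exists j, j != i.
    have : 0 < #|[set: D] :\ i|.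
      by move: D_gt1; rewrite -cardsT (cardsD1 i) inE.
    by case/card_gt0P => j; rewrite !inE andbT; exists j.
  have [z zC ez] : exists2 z, z \in C & block_adj (inl (inl (l, i))) z.
    apply: connect_neighbor (connC _ (inl (inl (l, j))) (allD i) (allD j)).
    by apply: contraNneq nij => -[->].
  have [zl fz nz] : [/\ block z == l, f z \in FD i & z \notin Dl].
    move: ez; rewrite /block_adj; case: z {zC} => [[[l' i']|[[l' i'] y]]|b] //=.
      rewrite orbF => /eqP[-> ->]; split; rewrite ?eqxx //.
        exact: (svalP (pD i)).
      by apply/imsetP => -[].
    by rewrite orbF => /andP[-> ->]; split=> //; apply/imsetP => -[].
  apply: (@not_disjointP _ _ _ (f z)) => //.
  by apply: imset_f; rewrite !inE zC zl nz.
- pose f (v : vertex) := match v with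
    | inl (inl li) => sval (pD li.2)
    | inl (inr liy) => sval (pW liy.2)
    | inr b => (tau b).2 end.
  apply: (@FW_hard (f @: Cl)).
    exact: leq_trans (leq_imset_card _ _) sCl.
  move=> y.
  have [z zC [zl fz]] :
      exists2 z, z \in C & block z == l /\ f z \in FW y.
    case: (boolP (inl (inr (l, i, y)) \in C)) => [wC|/domC[z zC ez]].
      exists (inl (inr (l, i, y))) => //=; rewrite eqxx; split=> //.
      exact: (svalP (pW y)).
    exists z => //; move: ez; rewrite /block_adj.
    case: z zC => [[li'|[[l' i'] y']]|b] zC //=.
      by move=> /eqP lie; rewrite lie zC in nDi.
    by rewrite orbF => /andP[].
  apply: (@not_disjointP _ _ _ (f z)) => //.
  by apply: imset_f; rewrite !inE zC zl.
Qed.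

Lemma block_gammac : #|L| * (#|D| + t).+1 <= gammac block_adj.
Proof.
have [C cC <-] := gammacP block_connected.
rewrite -sum1_card (partition_big block predT) //= -sum_nat_const.
apply: leq_sum => l _; apply: leq_trans (block_gammac_part l cC) _.
rewrite -sum1_card leq_eqVlt; apply/orP; left; apply/eqP.
by apply: eq_bigl => v; rewrite inE.
Qed.

Lemma block_M : #|L| * t <= M #|vertex| k.
Proof.
apply: leq_trans
  (M_ge (erefl _) block_simple block_connected block_min_degree).
rewrite leq_subRL; last exact: gamma_le_gammac block_connected.
apply: leq_trans block_gammac.
apply: leq_trans (leq_add block_gamma (leqnn _)) _.
by move: L_gt0; rewrite mulnS mulnDr; lia.
Qed.

End BlockGraph.

(** The residue modulo #|P| shares out 'I_r evenly among the elements of P. *)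
Lemma balanced_map (P : finType) (r : nat) : 0 < #|P| ->
  exists tau : 'I_r -> P, forall A : {set P},
    #|A| * (r %/ #|P|) <= #|[set b | tau b \in A]|.
Proof.
move=> P0; pose tau (b : 'I_r) : P := enum_val (Ordinal (ltn_pmod b P0)).
exists tau => A; pose c := r %/ #|P|.
have lt_r (pj : P * 'I_c) : pj.2 * #|P| + enum_rank pj.1 < r.
  apply: leq_trans (leq_trunc_div r #|P|).
  apply: leq_trans (_ : pj.2 * #|P| + #|P| <= _); first by rewrite ltn_add2l.
  by rewrite -mulSnr leq_mul2r ltn_ord orbT.
pose h pj := Ordinal (lt_r pj).
have hm pj : h pj %% #|P| = enum_rank pj.1 by rewrite /= modnMDl modn_small.
have hd pj : h pj %/ #|P| = pj.2.
  by rewrite /= divnMDl // divn_small ?addn0.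
have injh : injective h.
  move=> [p j] [p' j'] hh; congr pair.
    by apply: enum_rank_inj; apply: val_inj; have := hm (p, j); rewrite hh hm.
  by apply: val_inj; have := hd (p, j); rewrite hh hd.
have -> : #|A| * c = #|h @: setX A [set: 'I_c]|.
  by rewrite card_imset // cardsX cardsT card_ord.
apply: subset_leq_card; apply/subsetP => _ /imsetP[[p j] + ->].
rewrite !inE andbT /= => pA; suff -> : tau (h (p, j)) = p by [].
rewrite /tau -[RHS]enum_rankK; congr enum_val; apply: val_inj.
by rewrite [LHS]hm.
Qed.

(** * Greedy covering *)

Local Open Scope ring_scope.

Definition uncovered (X Y : finType) (r : X -> Y -> bool) (A : {set X})
  (s : seq Y) : {set X} := [set x in A | all (fun y => ~~ r x y) s].

(** Double counting the related pairs, some y in P is related to a proportion at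
    least q of the x that are still uncovered. *)
Lemma greedy_cover (R : realFieldType) (X Y : finType) (r : X -> Y -> bool)
    (A : {set X}) (P : {set Y}) (q : R) (m : nat) :
  (0 < #|P|)%N -> q <= 1 ->
  (forall x, x \in A -> q * #|P|%:R <= #|[set y in P | r x y]|%:R) ->
  exists s : seq Y, [/\ size s = m, {subset s <= P} &
    #|uncovered r A s|%:R <= (1 - q) ^+ m * #|A|%:R].
Proof.
move=> P0 q1 hq; elim: m => [|m [s [sz sP us]]].
  exists [::]; split=> //; rewrite expr0 mul1r ler_nat; apply: subset_leq_card.
  by apply/subsetP => x; rewrite inE => /andP[].
pose U := uncovered r A s.
have [y yP hy] : exists2 y, y \in P & q * #|U|%:R <= #|[set x in U | r x y]|%:R.
  apply/exists_inP; apply: contraT => /exists_inPn no.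
  have : \sum_(y in P) #|[set x in U | r x y]|%:R <
         \sum_(y in P) q * #|U|%:R :> R.
    apply: ltr_sum => [|y yP]; last by rewrite ltNge; apply: no.
    case/card_gt0P: P0 => y yP; apply/hasP.
    by exists y; first exact: mem_index_enum.
  rewrite sumr_const ltNge => /negP[].
  have -> : \sum_(y in P) #|[set x in U | r x y]|%:R =
            \sum_(x in U) #|[set y in P | r x y]|%:R :> R.
    transitivity (\sum_(y in P) \sum_(x in U | r x y) 1 : R).
      apply: eq_bigr => y _; rewrite -sum1_card natr_sum.
      by apply: eq_bigl => x; rewrite inE.
    rewrite (exchange_big_dep (mem U)) /=; last by move=> y x _ /andP[].
    apply: eq_bigr => x xU; rewrite -sum1_card natr_sum.
    by apply: eq_bigl => y; rewrite inE xU.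
  apply: le_trans (_ : \sum_(x in U) q * #|P|%:R <= _).
    by rewrite sumr_const -[leLHS]mulr_natr -[leRHS]mulr_natr mulrAC.
  by apply: ler_sum => x; rewrite inE => /andP[xA _]; apply: hq.
exists (y :: s); split; rewrite /= ?sz //.
  by move=> z; rewrite inE => /predU1P[->//|/sP].
have -> : uncovered r A (y :: s) = U :\: [set x in U | r x y].
  apply/setP => x; rewrite !inE /=; case: (x \in A) => //=.
  by case: (r x y); case: (all _ s).
rewrite cardsD natrB ?subset_leq_card ?subsetIl //.
have -> : U :&: [set x in U | r x y] = [set x in U | r x y].
  by apply/setP => x; rewrite !inE; case: (_ && all _ _).
apply: le_trans (_ : (1 - q) * #|U|%:R <= _).
  by rewrite mulrBl mul1r lerD2l lerN2.
by rewrite exprS -mulrA ler_wpM2l // subr_ge0.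
Qed.

(** * The upper bound *)

Section ClosedNeighborhoods.
Variables (T : finType) (e : rel T).
Hypotheses (simple_e : simple_graph e) (conn_e : connected_graph e).

Definition closed_adj (x y : T) : bool := (x == y) || e x y.

Lemma simple_sym : symmetric e.
Proof.
by case/andP: simple_e => _ /forallP s x y; apply/eqP; apply: (forallP (s x)).
Qed.

Lemma gamma_le_uncovered (s : seq T) :
  (gamma e <= size s + #|uncovered closed_adj [set: T] s|)%N.
Proof.
pose D := [set:: s] :|: uncovered closed_adj [set: T] s.
apply: leq_trans (_ : #|D| <= _)%N.
  apply: gamma_le; apply/dominatingP => x; rewrite !inE negb_or andTb.
  case/andP=> xs /allPn[y ys]; rewrite negbK => /orP[/eqP xy|exy].
    by rewrite xy ys in xs.
  by exists y; rewrite // !inE ys.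
apply: leq_trans (leq_card_setU _ _) _; rewrite leq_add2r.
by rewrite cardsE card_size.
Qed.

(** Every vertex of D outside [uncovered closed_adj D s1] is attached to s1, and
    those of s1 are attached to s2 in the same way, so that s2 and the two
    uncovered sets represent all components of the union. *)
Lemma gammac_le_uncovered (D : {set T}) (s1 s2 : seq T) : dominating e D ->
  (gammac e <= #|D| + size s1 + size s2 +
    2 * (#|uncovered closed_adj D s1| +
         #|uncovered closed_adj [set:: s1] s2| + size s2))%N.
Proof.
move=> domD.
set U1 := uncovered _ D s1; set U2 := uncovered _ _ s2.
pose D0 := D :|: [set:: s1] :|: [set:: s2].
pose R := U1 :|: U2 :|: [set:: s2].
have clos (A : {set T}) x (s : seq T) : x \in A ->
    x \notin uncovered closed_adj A s ->
    exists2 y, y \in s & closed_adj x y.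
  by move=> xA; rewrite inE xA /= => /allPn[y ys]; rewrite negbK; exists y.
have cl x y : x \in D0 -> y \in D0 -> closed_adj x y ->
    connect (induced e D0) x y.
  move=> xD yD /orP[/eqP->|exy]; first exact: connect0.
  by apply: connect1; rewrite inducedE xD yD.
have rep2 x : x \in s1 -> exists2 r, r \in R & connect (induced e D0) x r.
  move=> xs; case: (boolP (x \in U2)) => xU.
    by exists x; rewrite ?connect0 // 2!in_setU xU orbT.
  have [|y ys cxy] := clos _ _ _ _ xU; first by rewrite inE.
  exists y; first by rewrite in_setU [_ \in [set:: _]]inE ys orbT.
  by apply: cl; rewrite // !inE ?xs ?ys ?orbT.
have [||x|C cC sC] :=
  @connected_dominating_extension _ _ simple_sym D0 R conn_e.
- apply/dominatingP => x; rewrite !inE !negb_or -andbA => /and3P[xD _ _].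
  by have [y yD exy] := dominatingP _ _ domD x xD; exists y; rewrite // !inE yD.
- apply/subsetP => x; rewrite !inE.
  by case: (x \in D); case: (x \in s1); case: (x \in s2).
- rewrite !inE -orbA => /or3P[xD|/rep2//|xs].
    case: (boolP (x \in U1)) => xU.
      by exists x; rewrite ?connect0 // 2!in_setU xU.
    have [y ys cxy] := clos _ _ _ xD xU.
    have [r rR cyr] := rep2 y ys; exists r => //.
    by apply: connect_trans cyr; apply: cl; rewrite // !inE ?xD ?ys ?orbT.
  by exists x; rewrite ?connect0 // in_setU [_ \in [set:: _]]inE xs orbT.
apply: leq_trans (gammac_le conn_e cC) _; apply: leq_trans sC _.
have cs (s : seq T) : (#|[set:: s]| <= size s)%N by rewrite cardsE card_size.
apply: leq_add.
  rewrite /D0; apply: leq_trans (leq_card_setU _ _) (leq_add _ (cs _)).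
  by apply: leq_trans (leq_card_setU _ _) (leq_add _ (cs _)).
rewrite leq_mul2l /=; apply: leq_trans (leq_card_setU _ _) (leq_add _ (cs _)).
exact: leq_card_setU.
Qed.

Lemma closed_adj_greedy (R : realType) (k m : nat) (A : {set T}) :
  min_degree_ge e k ->
  let nu : R := #|T|%:R / k.+1%:R in 1 < nu ->
  exists2 s : seq T, size s = m &
    #|uncovered closed_adj A s|%:R <= (1 - nu^-1) ^+ m * #|A|%:R.
Proof.
move=> /forallP me nu nu1; have nu0 : 0 < nu by apply: lt_trans nu1.
have T0 : (0 < #|T|)%N.
  by move: nu1; rewrite /nu; case: #|T| => //; rewrite mul0r ltr10.
have [|||s [ss _ us]] := @greedy_cover R _ _ closed_adj A [set: T] nu^-1 m.
- by rewrite cardsT.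
- by rewrite invf_le1 ?ltW.
- move=> x _; rewrite cardsT /nu invf_div divfK ?pnatr_eq0 -?lt0n //.
  rewrite ler_nat.
  have -> : [set y in [set: T] | closed_adj x y] = x |: [set y | e x y].
    by apply/setP => y; rewrite !inE /closed_adj eq_sym.
  rewrite cardsU1 inE; case/andP: simple_e => /forallP/(_ x) -> _.
  exact: me.
by exists s.
Qed.

End ClosedNeighborhoods.

Section DominationRate.
Variable R : realType.
Implicit Types nu a : R.

(** The inverse of [nu * Phi nu]; each greedy step divides the uncovered part by
    [expR (rate nu)]. *)
Definition rate nu : R := ln (nu / (nu - 1)).

Lemma expR_rate nu : 1 < nu -> expR (- rate nu) = 1 - nu^-1.
Proof.
move=> nu1; have ? : nu - 1 != 0 by lra.
have ? : nu != 0 by lra.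
rewrite expRN /rate lnK; last first.
  by rewrite posrE divr_gt0 ?subr_gt0 // (lt_trans ltr01).
by field; apply/andP.
Qed.

Lemma rate_ge nu : 1 < nu -> nu^-1 <= rate nu.
Proof.
by move=> nu1; have := expR_ge1Dx (- rate nu); rewrite expR_rate //; lra.
Qed.

Lemma rate_gt0 nu : 1 < nu -> 0 < rate nu.
Proof.
by move=> nu1; apply: lt_le_trans (rate_ge nu1); rewrite invr_gt0; lra.
Qed.

Lemma rate_le nu : 1 < nu -> rate nu <= (nu - 1)^-1.
Proof.
move=> nu1; have ? : nu - 1 != 0 by lra.
rewrite /rate; have -> : nu / (nu - 1) = 1 + (nu - 1)^-1 by field.
have : 0 < (nu - 1)^-1 by rewrite invr_gt0 subr_gt0.
by move=> ?; apply: le_ln1Dx; lra.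
Qed.

Lemma Phi_rate nu : 1 < nu -> nu * Phi nu = (rate nu)^-1.
Proof.
move=> nu1; have := rate_gt0 nu1; rewrite /Phi -/(rate nu) => r0.
by field; apply/andP; split; lra.
Qed.

Lemma steps_exist nu a : 1 < nu -> 0 <= a ->
  exists2 m : nat, m%:R <= a / rate nu + 1 & (1 - nu^-1) ^+ m <= expR (- a).
Proof.
move=> nu1 a0; have r0 := rate_gt0 nu1.
have x0 : 0 <= a / rate nu by rewrite divr_ge0 // ltW.
have /andP[lo hi] := truncn_itv x0.
exists (Num.truncn (a / rate nu)).+1; first by rewrite -natr1 lerD2r.
rewrite -expR_rate // -expRM_natl mulrN ler_expR lerN2.
by rewrite -ler_pdivrMr // ltW.
Qed.

End DominationRate.

Lemma M_upper (R : realType) (n k : nat) :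
  let nu : R := n%:R / k.+1%:R in
  let u : R := ln (ln k.+1%:R) in
  1 < nu -> 1 <= u ->
  (M n k)%:R <= u / rate nu + nu * (12 + 3 * ln u).
Proof.
move=> nu u nu1 u1.
have nu0 : 0 < nu by apply: lt_trans nu1.
have r0 := rate_gt0 nu1.
have rinv : (rate nu)^-1 <= nu.
  by rewrite -[leRHS]invrK lef_pV2 ?posrE ?invr_gt0 // rate_ge.
have K0 : 0 < k.+1%:R :> R by rewrite ltr0n.
have lnu0 : 0 <= ln u by apply: ln_ge0.
pose y : R := ln k.+1%:R.
have y0 : 0 < y.
  by rewrite ltNge; apply/negP => /ln0; rewrite -[ln y]/u => ue; lra.
have yE : y = expR u by rewrite /u lnK.
have y2 : 2 <= y by rewrite yE; apply: le_trans (expR_ge1Dx u); lra.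
have KE : k.+1%:R = expR y by rewrite /y lnK.
have bound0 : 0 <= u / rate nu + nu * (12 + 3 * ln u).
  apply: addr_ge0; first by apply: divr_ge0; [lra|exact: ltW].
  by apply: mulr_ge0; [exact: ltW|lra].
pose P (x : nat) := x%:R <= u / rate nu + nu * (12 + 3 * ln u).
apply: (@M_ind n k P) => // e se ce me; rewrite /P.
have rate_steps a : 0 <= a -> a / rate nu <= a * nu.
  by move=> a0; rewrite ler_wpM2l.
have nuE : #|'I_n|%:R / k.+1%:R = nu by rewrite card_ord.
have nu1' : 1 < #|'I_n|%:R / k.+1%:R :> R by rewrite nuE.
have greedy a (A : {set 'I_n}) : 0 <= a -> exists2 s : seq 'I_n,
    (size s)%:R <= a / rate nu + 1 &
    #|uncovered (closed_adj e) A s|%:R <= expR (- a) * #|A|%:R.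
  move=> a0; have [m hm em] := steps_exist nu1 a0.
  have [s ss us] := @closed_adj_greedy _ e se R k m A me nu1'.
  exists s; first by rewrite ss.
  apply: le_trans us _; rewrite nuE; exact: ler_wpM2r.
(* About log K / rate nu greedy steps leave at most n / K = nu vertices
   undominated. *)
have gbound : (gamma e)%:R <= 2 * nu * y.
  have [s hs us] := greedy y [set: 'I_n] (ltW y0).
  have := gamma_le_uncovered e s; rewrite -(ler_nat R) natrD.
  move: us; rewrite cardsT card_ord expRN -KE mulrC -/nu => us.
  have := rate_steps y (ltW y0) => ?.
  have ? : nu * 2 <= nu * y by rewrite ler_pM2l.
  lra.
have [D domD cD] := gammaP e.
have u0 : 0 <= u by lra.
(* s1 covers D with the factor 1 / log K, then s2 covers s1 with the factor
   1 / u. *)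
have [s1 hs1] := greedy u D u0.
rewrite expRN -yE cD => us1.
have {}us1 : #|uncovered (closed_adj e) D s1|%:R <= 2 * nu.
  by apply: le_trans us1 _; rewrite mulrC ler_pdivrMr.
have [s2 hs2] := greedy (ln u) [set:: s1] lnu0.
rewrite expRN lnK ?posrE ?(lt_le_trans ltr01) // => us2.
have {}us2 : #|uncovered (closed_adj e) [set:: s1] s2|%:R <= 2 * nu.
  apply: le_trans us2 _; rewrite mulrC ler_pdivrMr ?(lt_le_trans ltr01) //.
  have : (#|[set:: s1]| <= size s1)%N by rewrite cardsE card_size.
  rewrite -(ler_nat R) => ?.
  have := rate_steps u u0 => ?.
  have : nu * 1 <= nu * u by rewrite ler_pM2l.
  lra.
have := gammac_le_uncovered se ce s1 s2 domD.
rewrite -(ler_nat R) mul2n -addnn !natrD cD => gc.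
have := rate_steps (ln u) lnu0 => ?.
rewrite natrB ?gamma_le_gammac //.
lra.
Qed.

(** * Set families that few points cannot hit *)

(** The proportion of k-subsets of N points that avoid s given points is a
    product of s factors (M - k) / M with N - s < M, each at least q. *)
Lemma binomial_ratio (R : realFieldType) (q : R) (N s k : nat) :
  0 <= q <= 1 -> (s <= N)%N -> k%:R <= (1 - q) * (N - s)%:R ->
  q ^+ s * 'C(N, k)%:R <= 'C(N - s, k)%:R.
Proof.
move=> /andP[q0 q1]; elim: s => [|s IH] sN hk; first by rewrite subn0 mul1r.
pose m := (N - s)%N.
have mE : (N - s.+1 = m.-1)%N by rewrite subnS.
have m0 : (0 < m)%N by rewrite subn_gt0.
have hk' : k%:R <= (1 - q) * m%:R.
  apply: le_trans hk _; apply: ler_wpM2l; first by rewrite subr_ge0.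
  by rewrite ler_nat mE leq_pred.
have km : (k <= m)%N.
  rewrite -(ler_nat R); apply: le_trans hk' _; rewrite ler_piMl ?ler0n //; lra.
apply: le_trans (_ : q * 'C(m, k)%:R <= _).
  by rewrite exprS -mulrA ler_wpM2l // IH // ltnW.
rewrite mE -(ler_pM2l (_ : 0 < m%:R :> R)) ?ltr0n //.
have -> : m%:R * 'C(m.-1, k)%:R = (m%:R - k%:R) * 'C(m, k)%:R :> R.
  by rewrite -natrB // -!natrM mul_bin_down.
by rewrite mulrA ler_wpM2r ?ler0n //; lra.
Qed.

(** Greedy covering, where the objects to be covered are the s-tuples of points
    and a set covers the tuples that miss it: each tuple misses a proportion at
    least q^s of the k-sets, so that m sets leave at most
    N^s (1 - q^s)^m < 1 tuples that hit them all. *)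
Lemma hard_family (R : realType) (q : R) (N k s m : nat) :
  0 <= q <= 1 -> (s <= N)%N -> (0 < N)%N -> k%:R <= (1 - q) * (N - s)%:R ->
  s%:R * ln N%:R < m%:R * q ^+ s ->
  exists2 F : 'I_m -> {set 'I_N}, forall i, #|F i| = k &
    forall S : {set 'I_N}, (#|S| <= s)%N -> ~ hitting F S.
Proof.
move=> /andP[q0 q1] sN N0 hk hm.
pose r (x : {ffun 'I_s -> 'I_N}) (K : {set 'I_N}) := [disjoint codom x & K].
pose P := [set K : {set 'I_N} | #|K| == k].
have cP : #|P| = 'C(N, k) by rewrite card_draws card_ord.
have kN : (k <= N)%N.
  rewrite -(ler_nat R); apply: le_trans hk _.
  apply: le_trans (_ : (N - s)%:R <= _); last by rewrite ler_nat leq_subr.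
  by rewrite ler_piMl ?ler0n //; lra.
have [|||F [sF FP]] := @greedy_cover R _ _ r [set: _] P (q ^+ s) m.
- by rewrite cP bin_gt0.
- exact: exprn_ile1.
- move=> x _; rewrite cP; apply: le_trans (binomial_ratio _ sN hk) _.
    by rewrite q0.
  rewrite ler_nat.
  apply: leq_trans (_ : 'C(#|~: [set z in codom x]|, k) <= _)%N.
    apply: leq_bin2l; rewrite cardsCs setCK card_ord leq_sub2l //.
    rewrite cardsE -[leqRHS]card_ord.
    by apply: leq_trans (card_size _) _; rewrite size_codom.
  rewrite -cards_draws; apply: subset_leq_card; apply/subsetP => K.
  rewrite !inE => /andP[sK ->] /=; rewrite /r disjoint_sym disjoint_subset.
  by apply/subsetP => z /(subsetP sK); rewrite !inE.
rewrite cardsT card_ffun !card_ord => hU.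
have {}hU : #|uncovered r [set: _] F| = 0%N.
  apply/eqP; rewrite -leqn0 -ltnS -(ltr_nat R); apply: le_lt_trans hU _.
  have NE : (N ^ s)%:R = expR (s%:R * ln N%:R) :> R.
    by rewrite expRM_natl lnK ?posrE ?ltr0n // natrX.
  have qs : (1 - q ^+ s) ^+ m <= expR (- (m%:R * q ^+ s)).
    rewrite -mulrN expRM_natl; apply: lerXn2r; rewrite ?nnegrE ?expR_ge0 //.
      by rewrite subr_ge0 exprn_ile1.
    exact: expR_ge1Dx.
  apply: le_lt_trans (ler_wpM2r _ qs) _; first by rewrite ler0n.
  rewrite NE -expRD expR_lt1; lra.
exists (fun i : 'I_m => nth set0 F i).
  move=> i; have /FP : nth set0 F i \in F by rewrite mem_nth ?sF.
  by rewrite inE => /eqP.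
move=> S sS hitS.
have z0 : 'I_N by exists 0%N.
pose x : {ffun 'I_s -> 'I_N} := [ffun i : 'I_s => nth z0 (enum S) i].
have Sx z : z \in S -> z \in codom x.
  rewrite -mem_enum => zS; have lt : (index z (enum S) < s)%N.
    by apply: leq_trans sS; rewrite cardE index_mem.
  by apply/codomP; exists (Ordinal lt); rewrite ffunE nth_index.
have : x \in uncovered r [set: _] F.
  rewrite !inE; apply/(all_nthP set0) => i iF.
  rewrite sF in iF; apply: contra (hitS (Ordinal iF)) => /=.
  by apply: disjointWl; apply/subsetP.
by rewrite (cards0_eq hU) inE.
Qed.

(** * The lower bound for given sizes *)

Section Families.
Local Open Scope nat_scope.

(** Both families are taken on the same N types, and the clique consists of the
    r vertices that D and the witnesses leave over, spread evenly over the
    pairs of a block and a type. *)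
Lemma M_lower_families (R : realType) (q : R) (n k l d m N k' t : nat) :
  let r := (n - l * d * m.+1)%N in
  (0 <= q <= 1)%R -> (0 < k)%N -> (0 < l)%N -> (1 < d)%N -> (d + t <= N)%N ->
  (k'%:R <= (1 - q) * (N - (d + t))%:R)%R ->
  (t%:R * ln N%:R < d%:R * q ^+ t)%R ->
  ((d + t)%:R * ln N%:R < m%:R * q ^+ (d + t))%R ->
  (l * d * m.+1 <= n)%N -> (k <= k' * (r %/ (l * N)))%N ->
  (l * t <= M n k)%N.
Proof.
move=> r q01 k0 l0 d1 dtN hk' ht hm hn hk.
have N0 : 0 < N by apply: leq_trans dtN; rewrite addn_gt0 ltnW.
have q1 : (0 <= 1 - q)%R by rewrite subr_ge0; case/andP: q01.
have [FD cFD hFD] : exists2 F : 'I_d -> {set 'I_N}, forall i, #|F i| = k' &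
    forall S : {set 'I_N}, #|S| <= t -> ~ hitting F S.
  apply: (@hard_family R q N k' t d) => //.
    by apply: leq_trans dtN; rewrite leq_addl.
  apply: (le_trans hk'); apply: ler_wpM2l => //.
  by rewrite ler_nat leq_sub2l // leq_addl.
have [FW cFW hFW] := @hard_family R q N k' (d + t) m q01 dtN N0 hk' hm.
have P0 : 0 < #|{: 'I_l * 'I_N}| by rewrite card_prod !card_ord muln_gt0 l0.
have [tau htau] := @balanced_map _ r P0.
have deg (x : 'I_l) (F : {set 'I_N}) : #|F| = k' ->
    k <= #|[set b | ((tau b).1 == x) && ((tau b).2 \in F)]|.
  move=> cF; apply: leq_trans hk _.
  have := htau (setX [set x] F).
  rewrite cardsX cards1 mul1n cF card_prod !card_ord.
  suff -> : [set b | tau b \in setX [set x] F] =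
            [set b | ((tau b).1 == x) && ((tau b).2 \in F)] by [].
  by apply/setP => b; rewrite !inE.
have k'N : k' < N.
  rewrite -(ltr_nat R); apply: (le_lt_trans hk').
  apply: (@le_lt_trans _ _ (N - (d + t))%:R%R).
    by rewrite ler_piMl ?ler0n //; lra.
  by rewrite ltr_nat; lia.
have rB : k < #|'I_r|.
  rewrite card_ord; apply: leq_trans (leq_trunc_div r (l * N)).
  have c0 : 0 < r %/ (l * N).
    by case: (r %/ _) hk => //; rewrite muln0 leqNgt k0.
  apply: leq_ltn_trans hk _; rewrite mulnC ltn_pmul2l //.
  by apply: leq_trans k'N _; rewrite leq_pmull.
have := @block_M 'I_l 'I_d 'I_m 'I_N 'I_r tau FD FW k t k0.
rewrite !card_ord => /(_ l0 d1).
rewrite card_ord in rB.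
move=> /(_ rB (fun x i => deg x _ (cFD i)) (fun x y => deg x _ (cFW y))).
move=> /(_ hFD hFW).
suff -> : #|vertex 'I_l 'I_d 'I_m 'I_r| = n by [].
rewrite /vertex !card_sum !card_prod !card_ord.
by have := subnKC hn; rewrite -/r mulnS.
Qed.

End Families.

(** A block has [n / l = K / p] vertices, so p plays the role of 1 / nu in a
    block; the slack eta absorbs the vertices of D and the witnesses as well
    as all the rounding. There are d ^ 2 types: many compared with d + t, so
    that the d + t points to be avoided hardly affect densities, yet only
    2 log d enters the condition on t. The number m of witnesses per vertex of
    D is about [4 * d ^ 2 * E] with E the square root of K. *)
Lemma M_lower_sizes (R : realType) (n k l d t : nat) (p eta : R) :
  let q := 1 - p - eta in
  let E := expR (ln k.+1%:R / 2) in
  (0 < k)%N -> (0 < l)%N -> 0 < p -> 0 < eta -> 0 <= q ->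
  p * n%:R = l%:R * k.+1%:R ->
  (t <= d)%N -> 6 <= d%:R * eta ->
  t%:R * ln (d ^ 2)%:R < d%:R * q ^+ t ->
  E^-1 <= q ^+ (d + d) ->
  7 * d%:R ^+ 3 * E <= eta / 2 * k.+1%:R ->
  (l * t <= M n k)%N.
Proof.
move=> q E k0 l0 p0 eta0 q0 pn td d_eta hD hq hE.
pose K : R := k.+1%:R.
have K1 : 1 <= K by rewrite ler1n.
have q1 : q <= 1 by rewrite /q; lra.
have l1 : 1 <= l%:R :> R by rewrite ler1n.
have d6 : 6 <= d%:R :> R.
  apply: le_trans d_eta _; rewrite ler_piMr ?ler0n //; rewrite /q in q0; lra.
have d1 : (6 <= d)%N by rewrite -(ler_nat R).
have E1 : 1 <= E by rewrite /E -[leLHS]expR0 ler_expR divr_ge0 // ln_ge0.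
pose N := (d ^ 2)%N; pose s := (d + t)%N.
have NE : N%:R = d%:R ^+ 2 :> R by rewrite natrX.
have sd : (s <= d + d)%N by rewrite leq_add2l.
have sN : (s <= N)%N.
  rewrite /N -mulnn (leq_trans sd) // addnn -mul2n.
  by rewrite leq_mul2r (leq_trans _ d1) ?orbT.
pose m := (Num.truncn (4 * d%:R ^+ 2 * E)).+1.
have x0 : 0 <= 4 * d%:R ^+ 2 * E.
  by rewrite !mulr_ge0 ?exprn_ge0 ?ler0n // ltW // (lt_le_trans ltr01).
have /andP[m_le m_gt] : (m%:R - 1 <= 4 * d%:R ^+ 2 * E < m%:R).
  have /andP[lo hi] := truncn_itv x0; rewrite /m hi andbT; move: lo.
  by rewrite -natr1; lra.
pose a := (p + eta) * (N - s)%:R.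
have a0 : 0 <= a by rewrite mulr_ge0 ?ler0n //; lra.
pose k' := Num.truncn a.
have /andP[k'_le k'_gt] := truncn_itv a0; rewrite -/k' -natr1 in k'_le k'_gt.
have dm : d%:R * m.+1%:R + N%:R <= eta / 2 * K :> R.
  apply: le_trans hE; rewrite -natr1 NE.
  have dd : 0 <= d%:R ^+ 2 * (E - 1) :> R.
    by rewrite mulr_ge0 ?exprn_ge0 ?ler0n // subr_ge0.
  have dE : 0 <= d%:R ^+ 2 * (d%:R - 6) * E :> R.
    by rewrite !mulr_ge0 ?exprn_ge0 ?ler0n ?subr_ge0 //; lra.
  have : d%:R * (m%:R + 1) <= d%:R * (4 * d%:R ^+ 2 * E + 2) :> R.
    by rewrite ler_wpM2l //; lra.
  have d2 : 0 <= d%:R * (d%:R - 6) :> R by rewrite mulr_ge0 //; lra.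
  lra.
have pe : p + eta <= 1 by rewrite /q in q0; lra.
have n0 : 0 < n%:R :> R.
  by rewrite -(pmulr_rgt0 _ p0) pn mulr_gt0 ?ltr0n.
have hn' : l%:R * (d%:R * m.+1%:R) <= l%:R * (eta / 2 * K) :> R.
  by rewrite ler_wpM2l ?ler0n // (le_trans _ dm) // lerDl ler0n.
have hnK : l%:R * (eta / 2 * K) <= n%:R.
  rewrite mulrCA -pn mulrA ler_piMl ?ler0n //.
  apply: mulr_ile1; lra.
have hn : (l * d * m.+1 <= n)%N.
  by rewrite -(ler_nat R) !natrM -mulrA (le_trans hn').
apply: (@M_lower_families R q n k l d m N k' t) => //.
- by rewrite q0 q1.
- exact: leq_trans d1.
- apply: le_trans k'_le _; rewrite /a ler_wpM2r ?ler0n //; rewrite /q; lra.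
- have qs : E^-1 <= q ^+ s by apply: le_trans hq _; apply: ler_wiXn2l.
  have lnd : ln N%:R <= 2 * d%:R :> R.
    rewrite NE lnXn ?(lt_le_trans _ d6) // -[ln _ *+ 2]mulr_natl ler_wpM2l //.
    by rewrite ltW // ln_sublinear // (lt_le_trans _ d6).
  apply: (@le_lt_trans _ _ (4 * d%:R ^+ 2)).
    have -> : 4 * d%:R ^+ 2 = (d + d)%:R * (2 * d%:R) :> R.
      by rewrite natrD; ring.
    apply: ler_pM; rewrite ?ler0n ?ler_nat //; apply: ln_ge0.
    by rewrite ler1n; apply: leq_trans sN; rewrite addn_gt0 (leq_trans _ d1).
  have E0 : 0 < E by apply: lt_le_trans E1.
  apply: (@lt_le_trans _ _ (m%:R * E^-1)); first by rewrite ltr_pdivlMr.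
  by rewrite ler_wpM2l ?ler0n.
(* It remains to check degrees: k' types out of N, with at least c vertices of
   the clique for each type in each block, give at least k neighbours. *)
set r := (n - l * d * m.+1)%N; set c := (r %/ (l * N))%N.
have N0 : 0 < N%:R :> R by rewrite NE exprn_gt0 // (lt_le_trans _ d6).
have cr : r%:R < (c%:R + 1) * (l%:R * N%:R) :> R.
  rewrite natr1 -!natrM ltr_nat; apply: ltn_ceil.
  by rewrite muln_gt0 l0 -(ltr_nat R).
have rE : r%:R = n%:R - l%:R * (d%:R * m.+1%:R) :> R.
  by rewrite natrB // !natrM mulrA.
have cN : K / p - eta / 2 * K <= c%:R * N%:R.
  rewrite -(ler_pM2l (_ : 0 < l%:R :> R)) ?ltr0n //.
  have -> : l%:R * (K / p - eta / 2 * K) = n%:R - l%:R * (eta / 2 * K).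
    have -> : n%:R = l%:R * K / p by rewrite -pn mulrAC mulfV ?mul1r ?gt_eqF.
    by ring.
  have : l%:R * (d%:R * m.+1%:R + N%:R) <= l%:R * (eta / 2 * K) :> R.
    by rewrite ler_wpM2l ?ler0n.
  move: cr; rewrite rE; lra.
have k'N : (p + eta / 2) * N%:R <= k'%:R.
  have sd' : s%:R <= 2 * d%:R :> R by rewrite mulr_natl mulr2n -natrD ler_nat.
  have aE : a = (p + eta) * (N%:R - s%:R) by rewrite /a natrB.
  have : (p + eta) * s%:R <= 2 * d%:R.
    by apply: le_trans sd'; rewrite ler_piMl ?ler0n.
  have : 3 * d%:R <= eta / 2 * N%:R :> R.
    rewrite NE expr2; have : 0 <= d%:R * (d%:R * eta - 6) :> R.
      by rewrite mulr_ge0 ?ler0n // subr_ge0.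
    by lra.
  move: k'_gt; rewrite aE; lra.
have Kle : K <= k'%:R * c%:R.
  have h0 : 0 <= K / p - eta / 2 * K.
    have : 0 <= (1 / p - eta / 2) * K.
      apply: mulr_ge0; last lra.
      have : 1 <= 1 / p by rewrite ler_pdivlMr //; lra.
      by move=> ?; lra.
    lra.
  have := ler_pM (_ : 0 <= p + eta / 2) h0
                 (_ : p + eta / 2 <= k'%:R / N%:R) cN.
  rewrite ler_pdivlMr // => /(_ _ k'N) h.
  apply: (@le_trans _ _ ((p + eta / 2) * (K / p - eta / 2 * K))).
    have -> : (p + eta / 2) * (K / p - eta / 2 * K) =
              K + eta / 2 * K * (1 / p - (p + eta / 2)).
      by field; lra.
    rewrite lerDl !mulr_ge0 ?subr_ge0 //; try lra.
    apply: (@le_trans _ _ 1); first lra.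
    by rewrite ler_pdivlMr //; lra.
  apply: le_trans (h _) _; first lra.
  have -> : k'%:R / N%:R * (c%:R * N%:R) = k'%:R * c%:R :> R by field; lra.
  by [].
by rewrite -(ler_nat R) natrM; apply: le_trans Kle; rewrite /K ler_nat.
Qed.

(** * Choice of the parameters *)

Section Asymptotics.
Variable R : realType.

Lemma expR_dominates (c C : R) (j : nat) : 0 < c ->
  exists x0, forall x, x0 <= x -> C * x ^+ j <= expR (c * x).
Proof.
move=> c0; pose f : R := j.+1`!%:R.
have f0 : 0 < f by rewrite ltr0n fact_gt0.
pose x0 := Num.max 0 (C * f / c ^+ j.+1).
exists x0 => x; rewrite ge_max => /andP[x_ge0 hx].
have := expR_ge1Dxn j (mulr_ge0 (ltW c0) x_ge0); apply: le_trans.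
apply: (@le_trans _ _ ((c * x) ^+ j.+1 / f)); last by rewrite lerDr.
move: hx; rewrite ler_pdivrMr ?exprn_gt0 // => hx.
rewrite ler_pdivlMr // exprMn.
have -> : C * x ^+ j * f = C * f * x ^+ j by ring.
have -> : c ^+ j.+1 * x ^+ j.+1 = x * c ^+ j.+1 * x ^+ j.
  by rewrite [x ^+ j.+1]exprS; ring.
by rewrite ler_wpM2r // exprn_ge0.
Qed.

Lemma rate_perturb (p eta q0 : R) :
  0 < p -> 0 <= eta -> 0 < q0 -> q0 <= 1 - p - eta ->
  - ln (1 - p - eta) <= rate p^-1 + eta / q0.
Proof.
move=> p0 eta0 q00 hq; have p1 : p < 1 by lra.
have nu1 : 1 < p^-1 by rewrite invf_gt1.
have q1 : 0 < 1 - p - eta by lra.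
have -> : rate p^-1 = - ln (1 - p).
  by rewrite -[p in RHS]invrK -expR_rate // expRK opprK.
have E : 1 - p = (1 - p - eta) * (1 + eta / (1 - p - eta)) by field; lra.
have h0 : 0 <= eta / (1 - p - eta) by rewrite divr_ge0 // ltW.
rewrite [X in - ln X + _]E lnM ?posrE //; last by lra.
have : ln (1 + eta / (1 - p - eta)) <= eta / (1 - p - eta).
  by apply: le_ln1Dx; lra.
have : eta / (1 - p - eta) <= eta / q0 by rewrite ler_wpM2l // lef_pV2.
lra.
Qed.

Lemma inverse_perturb (a b lam0 lam delta : R) : 0 < a -> 0 <= b ->
  0 <= delta -> a <= lam0 -> a <= lam -> lam <= lam0 + b ->
  lam0^-1 - (b / a ^+ 2 + delta / a) <= (1 - delta) / lam.
Proof.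
move=> a0 b0 d0 h0 h1 hb.
have l0 : 0 < lam0 by apply: lt_le_trans h0.
have l1 : 0 < lam by apply: lt_le_trans h1.
have e1 : delta / lam <= delta / a by rewrite ler_wpM2l // lef_pV2.
have e2 : lam0^-1 - lam^-1 <= b / a ^+ 2.
  have -> : lam0^-1 - lam^-1 = (lam - lam0) / (lam0 * lam) by field; lra.
  apply: (@le_trans _ _ (b / (lam0 * lam))).
    by apply: ler_wpM2r; [rewrite invr_ge0 mulr_ge0 // ltW|lra].
  rewrite ler_wpM2l // lef_pV2 ?posrE ?mulr_gt0 // expr2.
  by apply: ler_pM => //; apply: ltW.
lra.
Qed.

(** The number l of blocks keeps the density p = l / nu in a block bounded away
    from 0 and 1, uniformly in nu. One block is enough while nu is bounded; for
    larger nu the last inequality holds because [(rate x)^-1] lies between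
    x - 1 and x, so that l blocks lose at most l <= eps / 2 * nu. *)
Lemma block_count (sigma eps nu : R) :
  0 < sigma -> 0 < eps -> 1 + sigma <= nu ->
  exists l : nat, let p := l%:R / nu in
  [/\ (0 < l)%N, l%:R <= nu, (2 * (1 + sigma + 2 / eps))^-1 <= p,
      p <= (1 + sigma)^-1 &
      (rate nu)^-1 - eps / 2 * nu <= l%:R / rate p^-1].
Proof.
move=> s0 e0 hnu; pose nu1 := 1 + sigma + 2 / eps.
have e20 : 0 < 2 / eps by rewrite divr_gt0.
have nu10 : 0 < nu1 by rewrite /nu1; lra.
have nu0 : 0 < nu by lra.
have s10 : 0 < 1 + sigma by lra.
have en : 0 <= eps / 2 * nu by rewrite mulr_ge0 ?divr_ge0 // ltW.
have [small|big] := ltP nu nu1.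
  exists 1%N => p; have -> : p = nu^-1 by rewrite /p mul1r.
  rewrite invrK mul1r; split=> //; try lra.
    by rewrite lef_pV2 ?posrE ?mulr_gt0 // -/nu1; lra.
  by rewrite lef_pV2.
pose x := nu / nu1.
have x1 : 1 <= x by rewrite ler_pdivlMr // mul1r.
have x0 : 0 <= x by lra.
have /andP[lo hi] := truncn_itv x0.
set l := Num.truncn x in lo hi; rewrite -natr1 in hi.
have l1 : (0 < l)%N by rewrite truncn_gt0.
have l1R : 1 <= l%:R :> R by rewrite ler1n.
have lnu : l%:R * nu1 <= nu by rewrite -ler_pdivlMr.
exists l => p; have pl : p <= nu1^-1 by rewrite ler_pdivrMr // mulrC.
have ps : p <= (1 + sigma)^-1.
  by apply: le_trans pl _; rewrite lef_pV2 // /nu1; lra.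
have pE : p^-1 = nu / l%:R by rewrite invf_div.
have p1 : 1 < p^-1.
  rewrite pE ltr_pdivlMr ?ltr0n // mul1r; apply: lt_le_trans lnu.
  by rewrite ltr_pMr ?ltr0n // /nu1; lra.
split=> //.
- by apply: le_trans lnu; rewrite ler_peMr ?ler0n // /nu1; lra.
- have -> : (2 * (1 + sigma + 2 / eps))^-1 = x / 2 / nu.
    by rewrite -/nu1 /x; field; rewrite !gt_eqF.
  by apply: ler_wpM2r; [rewrite invr_ge0 ltW|lra].
- have r1 : (rate nu)^-1 <= nu.
    have nu_gt1 : 1 < nu by lra.
    by rewrite -[leRHS]invrK lef_pV2 ?posrE ?invr_gt0 ?rate_gt0 // rate_ge.
  have r2 : p^-1 - 1 <= (rate p^-1)^-1.
    rewrite -[leLHS]invrK lef_pV2 ?posrE ?invr_gt0 ?rate_gt0 ?subr_gt0 //.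
    exact: rate_le.
  have : l%:R * (p^-1 - 1) <= l%:R / rate p^-1 by rewrite ler_wpM2l.
  have -> : l%:R * (p^-1 - 1) = nu - l%:R by rewrite pE; field; lra.
  have : l%:R * (2 / eps) <= nu.
    by apply: le_trans lnu; rewrite ler_wpM2l // /nu1; lra.
  rewrite mulrA ler_pdivrMr // => ?; lra.
Qed.

End Asymptotics.

(** Here d is about rho * log K, with rho so small that q ^ (2 d) is at least
    the inverse of the square root of K for every admissible density, and t is
    about (1 - delta) u / lam with lam = - log q. The d sets of the first family
    resist t points because d q ^ t >= d exp (- (1 - delta) u) is of order
    (log K) ^ delta, whereas t log (d ^ 2) is only of order u ^ 2. *)
Lemma M_lower_blocks (R : realType) (pmin q0 delta eta : R) :
  0 < pmin -> 0 < q0 < 1 -> 0 < delta < 1 -> 0 < eta <= 1 ->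
  exists u0 : R, forall k n l : nat,
    let nu : R := n%:R / k.+1%:R in
    let u := ln (ln k.+1%:R) in
    let p := l%:R / nu in
    let q := 1 - p - eta in
    u0 <= u -> 0 < nu -> (0 < l)%N -> pmin <= p -> q0 <= q ->
    l%:R * ((1 - delta) * u / - ln q - 1) <= (M n k)%:R.
Proof.
move=> pmin0 /andP[q00 q01] /andP[delta0 delta1] /andP[eta0 eta1].
pose Lam := - ln q0.
have Lam0 : 0 < Lam by rewrite oppr_gt0 ln_lt0 // q00.
pose rho := (4 * (Lam + 1))^-1.
have L1 : 0 < Lam + 1 by rewrite addr_gt0.
have rho0 : 0 < rho by rewrite invr_gt0 mulr_gt0.
have rho1 : rho <= 1 by rewrite invf_le1 ?mulr_gt0 //; lra.
have rhoLam : rho * Lam <= 1 / 4.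
  by rewrite /rho mulrC ler_pdivrMr ?mulr_gt0 //; lra.
have half0 : 0 < 1 / 2 :> R by lra.
have [u1 hu1] := expR_dominates (5 / (rho * pmin)) 2 delta0.
have [u2 hu2] := expR_dominates (2 / (rho * pmin)) 1 ltr01.
have [u3 hu3] := expR_dominates (12 / (eta * rho)) 0 ltr01.
have [u4 hu4] := expR_dominates (14 / eta) 3 half0.
exists (Num.max (Num.max (Num.max u1 u2) (Num.max u3 u4)) 1).
move=> k n l nu u p q; rewrite !ge_max.
move=> /andP[/andP[/andP[h1 h2] /andP[h3 h4]] h5] nu0 l0 p_ge qq0.
have u_gt0 : 0 < u by apply: lt_le_trans h5.
pose K : R := k.+1%:R; pose y := ln K.
have y0 : 0 < y.
  rewrite ltNge; apply: contraTN u_gt0 => /ln0; rewrite -[ln y]/u => ->.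
  by rewrite ltxx.
have yE : y = expR u by rewrite lnK.
have uy : u <= y by rewrite yE; apply: le_trans (expR_ge1Dx u); rewrite lerDr.
have {u1 h1}hu1 := hu1 u h1.
have {u2 h2}hu2 : 2 * u <= rho * y * pmin.
  have := hu2 u h2; rewrite expr1 mul1r -yE mulrAC ler_pdivrMr ?mulr_gt0 //.
  by rewrite mulrA [y * _]mulrC.
have {u3 h3}hu3 : 12 <= rho * y * eta.
  have := hu3 u h3; rewrite expr0 mulr1 mul1r -yE ler_pdivrMr ?mulr_gt0 //.
  by rewrite [eta * _]mulrC mulrA [y * _]mulrC.
have {u4 h4}hu4 : 14 * y ^+ 3 <= expR (y / 2) * eta.
  have := hu4 y (le_trans h4 uy); rewrite mulrAC ler_pdivrMr //.
  by rewrite div1r [2^-1 * y]mulrC.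
have K0 : 0 < K by rewrite ltr0n.
have k0 : (0 < k)%N.
  rewrite lt0n; apply: contraTneq y0 => k_eq0.
  by rewrite /y /K k_eq0 ln1 ltxx.
have n0 : 0 < n%:R :> R by move: nu0; rewrite /nu pmulr_lgt0 // invr_gt0.
have p0 : 0 < p by apply: lt_le_trans p_ge.
have q_gt0 : 0 < q by apply: lt_le_trans qq0.
have q_lt1 : q < 1 by clear -eta0 p0; rewrite /q; lra.
set lam := - ln q.
have lamE : expR (- lam) = q by rewrite /lam opprK lnK.
have lam_ge : pmin <= lam.
  have := expR_ge1Dx (- lam); rewrite lamE /q; clear -p_ge eta0; lra.
have lam0 : 0 < lam by apply: lt_le_trans lam_ge.
have du0 : 0 <= (1 - delta) * u by rewrite mulr_ge0 ?subr_ge0 // ltW.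
have x0 : 0 <= (1 - delta) * u / lam by rewrite divr_ge0 // ltW.
pose t := Num.truncn ((1 - delta) * u / lam).
have /andP[t_le t_gt] := truncn_itv x0; rewrite -/t -natr1 in t_le t_gt.
have ry0 : 0 <= rho * y by rewrite mulr_ge0 ?ltW.
have ry12 : 12 <= rho * y by apply: le_trans hu3 _; rewrite ler_piMr.
pose d := Num.truncn (rho * y).
have /andP[d_le d_gt] := truncn_itv ry0; rewrite -/d -natr1 in d_le d_gt.
have d_half : rho * y / 2 <= d%:R by clear -ry12 d_gt; lra.
have d_y : d%:R <= y by apply: le_trans d_le _; rewrite ler_piMl // ltW.
have d0 : 0 < d%:R :> R by clear -ry12 d_half; lra.
have t_u : t%:R <= u / pmin.
  apply: le_trans t_le _; apply: ler_pM => //.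
  - by rewrite invr_ge0 ltW.
  - by rewrite ler_piMl ?ltW //; clear -delta0; lra.
  - by rewrite lef_pV2.
have u_d : u / pmin <= d%:R.
  by apply: le_trans d_half; rewrite ler_pdivrMr //; clear -hu2; lra.
suff lt_M : (l * t <= M n k)%N.
  apply: (@le_trans _ _ (l * t)%:R); last by rewrite ler_nat.
  by rewrite natrM ler_wpM2l // lerBlDr ltW.
apply: (@M_lower_sizes R n k l d t p eta) => //.
- exact: ltW.
- by rewrite /p /nu invf_div mulrA divfK ?gt_eqF.
- by rewrite -(ler_nat R); apply: le_trans t_u u_d.
- have : rho * y / 2 * eta <= d%:R * eta by rewrite ler_wpM2r // ltW.
  by clear -hu3; lra.
- have lnd : ln d%:R <= u by rewrite ler_ln ?posrE.
  have qt : expR (- ((1 - delta) * u)) <= q ^+ t.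
    rewrite -lamE -expRM_natl ler_expR mulrN lerN2.
    by rewrite -ler_pdivlMr.
  have d1 : 1 <= d%:R :> R by rewrite ler1n -(ltr_nat R).
  rewrite natrX lnXn // -[ln _ *+ 2]mulr_natl.
  apply: (@le_lt_trans _ _ (u / pmin * (2 * u))).
    by apply: ler_pM => //; [rewrite mulr_ge0 // ln_ge0|rewrite ler_wpM2l].
  apply: (@lt_le_trans _ _ (rho * y / 2 * expR (- ((1 - delta) * u))));
      last first.
    by apply: ler_pM => //; rewrite ?expR_ge0 // divr_ge0.
  rewrite yE; have -> : rho * expR u / 2 * expR (- ((1 - delta) * u)) =
      rho / 2 * expR (delta * u).
    have -> : delta * u = u + - ((1 - delta) * u) by ring.
    by rewrite expRD; ring.
  apply: (@lt_le_trans _ _ (rho / 2 * (5 / (rho * pmin) * u ^+ 2)));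
      last first.
    by rewrite ler_wpM2l // divr_ge0 // ltW.
  have -> : rho / 2 * (5 / (rho * pmin) * u ^+ 2) = 5 / 2 * (u ^+ 2 / pmin).
    by field; rewrite !gt_eqF.
  have -> : u / pmin * (2 * u) = 2 * (u ^+ 2 / pmin) by ring.
  have : 0 < u ^+ 2 / pmin by rewrite divr_gt0 ?exprn_gt0.
  by clear; lra.
- rewrite -/K -/y -/q -expRN.
  apply: (@le_trans _ _ (q0 ^+ (d + d))); last first.
    by apply: lerXn2r => //; rewrite nnegrE ltW.
  have -> : q0 = expR (- Lam) by rewrite opprK lnK.
  rewrite -expRM_natl ler_expR mulrN lerN2 natrD.
  have : d%:R * Lam <= rho * y * Lam by rewrite ler_wpM2r // ltW.
  have : rho * Lam * y <= 1 / 4 * y by rewrite ler_wpM2r // ltW.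
  by clear; lra.
- rewrite -/K -/y.
  have d3 : d%:R ^+ 3 <= y ^+ 3 by apply: lerXn2r => //; rewrite nnegrE ltW.
  have -> : K = expR (y / 2) * expR (y / 2) by rewrite -expRD -splitr /y lnK.
  rewrite mulrA ler_wpM2r ?expR_ge0 //.
  by clear -d3 hu4; lra.
Qed.

(** Both perturbations, the slack eta in the density and delta in t, are chosen
    so small that together they cost at most eps / 4 in 1 / rate. *)
Lemma M_lower (R : realType) (sigma eps : R) : 0 < sigma -> 0 < eps ->
  exists u0 : R, forall k n : nat,
    let nu : R := n%:R / k.+1%:R in
    let u := ln (ln k.+1%:R) in
    u0 <= u -> 1 + sigma <= nu ->
    u / rate nu - eps * nu * u < (M n k)%:R.
Proof.
move=> s0 e0.
have s10 : 0 < 1 + sigma by rewrite addr_gt0.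
pose pmin := (2 * (1 + sigma + 2 / eps))^-1.
have pmin0 : 0 < pmin by rewrite invr_gt0 mulr_gt0 // !addr_gt0 ?divr_gt0.
pose q0 := sigma / (2 * (1 + sigma)).
have q00 : 0 < q0 by rewrite divr_gt0 // mulr_gt0.
have q0E : (1 + sigma)^-1 = 1 - q0 - q0 by rewrite /q0; field; rewrite gt_eqF.
have q01 : q0 < 1 / 2.
  have : 0 < (1 + sigma)^-1 by rewrite invr_gt0.
  by rewrite q0E; lra.
pose delta := Num.min (1 / 2) (pmin * eps / 8).
have delta0 : 0 < delta by rewrite lt_min !divr_gt0 //= mulr_gt0.
have delta1 : delta <= 1 / 2 by rewrite ge_min lexx.
have delta2 : delta / pmin <= eps / 8.
  rewrite ler_pdivrMr //; have -> : eps / 8 * pmin = pmin * eps / 8 by ring.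
  by rewrite ge_min lexx orbT.
pose eta := Num.min q0 (q0 * (pmin ^+ 2 * eps / 8)).
have eta0 : 0 < eta.
  by rewrite lt_min q00 mulr_gt0 // divr_gt0 // mulr_gt0 // exprn_gt0.
have eta1 : eta <= q0 by rewrite ge_min lexx.
have eta2 : eta / q0 / pmin ^+ 2 <= eps / 8.
  rewrite ler_pdivrMr ?exprn_gt0 // ler_pdivrMr //.
  have -> : eps / 8 * pmin ^+ 2 * q0 = q0 * (pmin ^+ 2 * eps / 8) by ring.
  by rewrite ge_min lexx orbT.
have [||||u0 hu0] := @M_lower_blocks R pmin q0 delta eta => //.
- by rewrite q00; lra.
- by rewrite delta0; lra.
- by rewrite eta0; lra.
exists (Num.max u0 (5 / eps)) => k n nu u; rewrite ge_max => /andP[h0 h1] hnu.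
have u_eps : 5 <= u * eps by rewrite -ler_pdivrMr.
have u_gt0 : 0 < u by apply: lt_le_trans h1; rewrite divr_gt0.
have nu0 : 0 < nu by apply: lt_le_trans hnu.
have [l [l0 lnu p_ge p_le hl]] := block_count s0 e0 hnu.
have := hu0 k n l h0 nu0 l0 p_ge.
rewrite -/nu -/u; set p := l%:R / nu in p_ge p_le hl *; set q := 1 - p - eta.
have qq0 : q0 <= q by rewrite /q; clear -p_le q0E eta1; lra.
have p0 : 0 < p by apply: lt_le_trans p_ge.
move=> /(_ qq0); apply: lt_le_trans; set lam := - ln q.
have p1 : 1 < p^-1 by rewrite invf_gt1 //; clear -q0E q00 p_le; lra.
have r_ge : pmin <= rate p^-1 by apply: le_trans (rate_ge p1); rewrite invrK.
have lam_ge : pmin <= lam.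
  have lamE : expR (- lam) = q.
    by rewrite /lam opprK lnK ?posrE ?(lt_le_trans q00).
  have := expR_ge1Dx (- lam); rewrite lamE /q.
  by move: p_ge; rewrite -/pmin; clear -eta0; lra.
have lam_le : lam <= rate p^-1 + eta / q0.
  by apply: rate_perturb => //; apply: ltW.
have eq0 : 0 <= eta / q0 by rewrite divr_ge0 // ltW.
have hlam := inverse_perturb pmin0 eq0 (ltW delta0) r_ge lam_ge lam_le.
have {}hlam : (rate p^-1)^-1 - eps / 4 <= (1 - delta) / lam.
  by clear -hlam delta2 eta2; lra.
have l1 : 1 <= l%:R :> R by rewrite ler1n.
have e1 : l%:R * u * ((rate p^-1)^-1 - eps / 4) <=
          l%:R * u * ((1 - delta) / lam).
  by rewrite ler_wpM2l // mulr_ge0 // ltW.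
have e2 : u * ((rate nu)^-1 - eps / 2 * nu) <= u * (l%:R / rate p^-1).
  by rewrite ler_wpM2l // ltW.
have e3 : l%:R * (u * eps / 4 + 1) < nu * (u * eps / 2).
  apply: (@le_lt_trans _ _ (nu * (u * eps / 4 + 1))).
    by rewrite ler_wpM2r //; clear -u_eps; lra.
  by rewrite ltr_pM2l //; clear -u_eps; lra.
have -> : l%:R * ((1 - delta) * u / lam - 1) =
          l%:R * u * ((1 - delta) / lam) - l%:R by ring.
by clear -e1 e2 e3; lra.
Qed.

(** * The asymptotic formula *)

Lemma lnln_unbounded (R : realType) (x : R) :
  exists k0 : nat, forall k, (k0 <= k)%N -> x <= ln (ln k.+1%:R).
Proof.
exists (Num.truncn (expR (expR x))) => k hk.
have h : expR (expR x) <= k.+1%:R.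
  apply: ltW; apply: lt_le_trans (truncnS_gt _) _; by rewrite ler_nat ltnS.
have K0 : 0 < k.+1%:R :> R by rewrite ltr0n.
have h' : expR x <= ln k.+1%:R by rewrite -ler_expR lnK.
by rewrite -ler_expR lnK // posrE (lt_le_trans (expR_gt0 x)).
Qed.

Lemma ln_negligible (R : realType) (eps : R) : 0 < eps ->
  exists u0, forall u, u0 <= u -> 1 <= u /\ 12 + 3 * ln u < eps * u.
Proof.
move=> e0; have [w0 hw0] := @expR_dominates R 1 (16 / eps) 1 ltr01.
exists (expR (Num.max w0 1)) => u hu.
have u0 : 0 < u by apply: lt_le_trans hu; apply: expR_gt0.
have : Num.max w0 1 <= ln u by rewrite -ler_expR lnK.
rewrite ge_max => /andP[h0 h1].
have uE : expR (ln u) = u by rewrite lnK.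
split; first by have := expR_ge1Dx (ln u); rewrite uE; lra.
have := hw0 _ h0; rewrite expr1 mul1r uE mulrAC ler_pdivrMr //; lra.
Qed.

Theorem theorem1p7 (R : realType) (sigma eps : R) :
  0 < sigma -> 0 < eps ->
  exists k0 : nat, forall k n : nat, (k0 <= k)%N ->
    let nu : R := n%:R / (k.+1)%:R in
    1 + sigma <= nu ->
    - eps < (M n k)%:R / (nu * ln (ln (k.+1)%:R)) - Phi nu < eps.
Proof.
move=> s0 e0.
have [u1 low] := M_lower s0 e0.
have [u2 neg] := ln_negligible e0.
have [k0 large] := lnln_unbounded (Num.max u1 u2).
exists k0 => k n /large; rewrite ge_max => /andP[h1 h2] nu hnu.
have [u_ge1 u_neg] := neg _ h2.
have := low k n h1 hnu; rewrite -/nu.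
set u := ln (ln k.+1%:R) in u_ge1 u_neg h1 h2 *; move=> lower.
have nu1 : 1 < nu by lra.
have nu0 : 0 < nu by lra.
have upper : (M n k)%:R <= u / rate nu + nu * (12 + 3 * ln u) by apply: M_upper.
have nuu0 : 0 < nu * u by rewrite mulr_gt0 //; lra.
have PhiE : u / rate nu = Phi nu * (nu * u) by rewrite -Phi_rate //; ring.
rewrite ltrBDr ltr_pdivlMr // ltrBlDr ltr_pdivrMr // !mulrDl -PhiE.
have : nu * (12 + 3 * ln u) < nu * (eps * u) by rewrite ltr_pM2l.
by move=> ?; apply/andP; split; lra.
Qed.
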